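(* For every integer $d\ge1$ there exist constants $0<c_d\le C_d<\infty$, depending only on $d$, such that for every finite connected graph $G=(V_G,E_G)$ with at least two vertices and maximum degree $d$, the modified log-Sobolev constant $t_{\mathrm{MLS}}$ of the Lamplighter chain on $G$ satisfies $$c_d\,\frac{|V_G|}{\gamma(G)}\ \le\ t_{\mathrm{MLS}}\ \le\ C_d\,\frac{|V_G|}{\gamma(G)},$$ where $\gamma(G)$ is the spectral gap of $G$.
   Context: Graphs are simple and undirected; $j\sim i$ means $\{i,j\}\in E_G$. The spectral gap $\gamma(G)$ is the spectral gap of simple random walk on $G$, i.e. the smallest non-zero eigenvalue of $I-P$, where $P(i,j)=\frac{1}{\deg(i)}\mathbf 1_{j\sim i}$. The Lamplighter chain on $G$ is the continuous-time Markov chain on $\mathcal X=V_G\times\{0,1\}^{V_G}$ whose generator acts on $f:\mathcal X\to\mathbb R$ by $$(Qf)(i,\sigma)=\frac12\left(f(i,\sigma^i)-f(i,\sigma)\right)+\frac{1}{2\deg(i)}\sum_{j\sim i}\left(f(j,\sigma)-f(i,\sigma)\right),$$ where $\sigma^i$ is obtained from $\sigma$ by replacing $\sigma_i$ with $1-\sigma_i$. It is irreducible and reversible with respect to the probability measure $\pi(i,\sigma)\propto\deg(i)$. For a generator $Q$ on a finite set $\mathcal X$ reversible with respect to a probability measure $\pi$, let $\mathcal E(f,g)=\frac12\sum_{x,y\in\mathcal X}\pi(x)Q(x,y)(f(x)-f(y))(g(x)-g(y))$ and, for $f:\mathcal X\to(0,\infty)$, $\mathrm{Ent}(f)=\mathbf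 E[f\log f]-\mathbf E[f]\log\mathbf E[f]$, with $\mathbf E$ the expectation under $\pi$ and $\log$ natural. The modified log-Sobolev constant $t_{\mathrm{MLS}}$ is the smallest $t\ge0$ such that $\mathrm{Ent}(f)\le t\,\mathcal E(f,\log f)$ for all $f:\mathcal X\to(0,\infty)$. *)

(* Defs.v *)
From HB Require Import structures.
From mathcomp Require Import all_boot all_order all_algebra.
From mathcomp Require Import all_classical all_reals all_analysis.

Set Implicit Arguments.
Unset Strict Implicit.
Unset Printing Implicit Defensive.

Import Order.TTheory GRing.Theory Num.Theory.

Local Open Scope classical_set_scope.
Local Open Scope ring_scope.

(* A graph on the finite vertex type V is given by its adjacency relation. *)

Definition simple_graph (V : finType) (e : rel V) : Prop :=
  symmetric e /\ irreflexive e.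

Definition connected_graph (V : finType) (e : rel V) : Prop :=
  forall i j : V, connect e i j.

Definition deg (V : finType) (e : rel V) (i : V) : nat :=
  #|[set j | e i j]%SET|.

Definition max_deg (V : finType) (e : rel V) : nat := (\max_(i : V) deg e i)%N.

(* Vertices are numbered by enum_val in order to use the library's matrices. *)
Definition srw_matrix (R : realType) (V : finType) (e : rel V) : 'M[R]_#|V| :=
  \matrix_(a, b) ((deg e (enum_val a))%:R^-1
                  * (e (enum_val a) (enum_val b))%:R).

Arguments srw_matrix R {V} e.

Definition nonzero_eigenvalues (R : realType) (V : finType) (e : rel V) :
    set R :=
  [set a | eigenvalue (1%:M - srw_matrix R e) a /\ a != 0].

Arguments nonzero_eigenvalues R {V} e.

(* The library's eigenvalue quantifies over row (left) eigenvectors; this gives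
   the same eigenvalues as the action of I - P on functions.
   I - P has finitely many eigenvalues, so the infimum is a minimum as soon as
   a nonzero eigenvalue exists: see spectral_gap_min. As P is self-adjoint with
   respect to deg, all its eigenvalues are real. *)
Definition spectral_gap (R : realType) (V : finType) (e : rel V) : R :=
  inf (nonzero_eigenvalues R e).

Arguments spectral_gap R {V} e.

Section FiniteChain.
Context (R : realType) (X : finType).

(* A generator is given by its action on functions; Q(x,y) = (Q 1_y)(x). *)
Definition rate (Q : (X -> R) -> X -> R) (x y : X) : R :=
  Q (fun z => (z == y)%:R) x.

Definition dirichlet (pi : X -> R) (Q : (X -> R) -> X -> R) (f g : X -> R) : R :=
  2^-1 * \sum_(x : X) \sum_(y : X)
           pi x * rate Q x y * (f x - f y) * (g x - g y).

Definition expect (pi f : X -> R) : R := \sum_(x : X) pi x * f x.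

Definition entropy (pi f : X -> R) : R :=
  expect pi (fun x => f x * ln (f x)) - expect pi f * ln (expect pi f).

Definition mls_constants (pi : X -> R) (Q : (X -> R) -> X -> R) : set R :=
  [set t | 0 <= t /\
     forall f : X -> R, (forall x, 0 < f x) ->
       entropy pi f <= t * dirichlet pi Q f (fun x => ln (f x))].

(* The infimum is a minimum as soon as some admissible constant exists: see
   t_MLS_min. *)
Definition t_MLS (pi : X -> R) (Q : (X -> R) -> X -> R) : R :=
  inf (mls_constants pi Q).

End FiniteChain.

Definition flip (V : finType) (i : V) (s : {ffun V -> bool}) :
    {ffun V -> bool} :=
  [ffun v => if v == i then ~~ s v else s v].

Definition lamp_state (V : finType) : finType := (V * {ffun V -> bool})%type.

Definition lamp_gen (R : realType) (V : finType) (e : rel V)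
    (f : lamp_state V -> R) (x : lamp_state V) : R :=
  let: (i, s) := x in
  2^-1 * (f (i, flip i s) - f (i, s))
  + (2 * (deg e i)%:R)^-1 * \sum_(j | e i j) (f (j, s) - f (i, s)).

Definition lamp_pi (R : realType) (V : finType) (e : rel V)
    (x : lamp_state V) : R :=
  (deg e x.1)%:R / \sum_(y : lamp_state V) (deg e y.1)%:R.

Arguments lamp_pi R {V} e x.

Lemma finite_inf_min (R : realType) (S : set R) :
  finite_set S -> S !=set0 -> S (inf S) /\ lbound S (inf S).
Proof.
move=> /finite_seqP[s ->] [x0 /= x0s].
have [m ms mle] : exists2 m, m \in s & {in s, forall x, m <= x}.
  elim: s x0 x0s => [//|y s IHs] _ _; case: s IHs => [_|z s IHs].
    by exists y => [|x]; rewrite inE // => /eqP ->.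
  have [m ms mle] := IHs z (mem_head _ _).
  have [ym|my] := leP y m.
    exists y => [|x]; first exact: mem_head.
    by rewrite inE => /predU1P[-> //|/mle]; apply: le_trans.
  exists m => [|x]; first by rewrite inE ms orbT.
  by rewrite inE => /predU1P[->|/mle //]; apply: ltW.
suff -> : inf [set` s] = m by split=> // x /= /mle.
apply/eqP; rewrite eq_le; apply/andP; split.
  by apply: ge_inf => //; exists m => x /= /mle.
by apply: lb_le_inf; [exists m | move=> x /= /mle].
Qed.

Lemma finite_eigenvalues (F : fieldType) n (A : 'M[F]_n) :
  finite_set [set a | eigenvalue A a].
Proof.
apply: contrapT => /(infinite_set_fset n.+1)[B sB nB].
have pn0 : char_poly A != 0 by rewrite monic_neq0 ?char_poly_monic.
have := max_poly_roots (rs := finmap.enum_fset B) pn0.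
rewrite size_char_poly ltnNge nB => H; suff: false by []; apply: H.
  by apply/allP => a aB; rewrite -eigenvalue_root_char; apply: sB.
exact: finmap.fset_uniq.
Qed.

Lemma spectral_gap_min (R : realType) (V : finType) (e : rel V) :
  nonzero_eigenvalues R e !=set0 ->
  nonzero_eigenvalues R e (spectral_gap R e) /\
  lbound (nonzero_eigenvalues R e) (spectral_gap R e).
Proof.
apply: finite_inf_min.
by apply: sub_finite_set (finite_eigenvalues (1%:M - srw_matrix R e)) => a [].
Qed.

Lemma t_MLS_min (R : realType) (X : finType) (pi : X -> R)
    (Q : (X -> R) -> X -> R) :
  mls_constants pi Q !=set0 ->
  mls_constants pi Q (t_MLS pi Q) /\ lbound (mls_constants pi Q) (t_MLS pi Q).
Proof.
move=> N0.
have lb : lbound (mls_constants pi Q) (t_MLS pi Q).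
  by apply: ge_inf; exists 0 => t [].
split=> //; split; first by apply: lb_le_inf => // t [].
move=> f f0; set D := dirichlet _ _ _ _.
have [D0|D0] := leP D 0.
  have [t tS] := N0; apply: (le_trans (tS.2 f f0)).
  by apply: ler_wnM2r => //; apply: lb.
rewrite -ler_pdivrMr //; apply: lb_le_inf => // t [_ /(_ f f0)].
by rewrite ler_pdivrMr.
Qed.

(* Main.v *)
Require Import Defs.
From HB Require Import structures.
From mathcomp Require Import all_boot all_order all_algebra.
From mathcomp Require Import all_classical all_reals all_analysis.
From mathcomp Require Import zify ring lra.

Set Implicit Arguments.
Unset Strict Implicit.
Unset Printing Implicit Defensive.

Import Order.TTheory GRing.Theory Num.Theory.
Local Open Scope ring_scope.

(**
Write [g] for the square root of a density [f] and [mu] for the stationary law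
of the walk.

Upper bound. The entropy of [f] splits into the entropies of the walker given
the lamps and the entropy of the lamp marginal [m]. The former are at most
[C n / gamma] times the energy of [g], by a crude bound of entropy by variance
over the minimum of [mu] and the Poincare inequality. The latter is, by the
log-Sobolev inequality on the hypercube, at most the sum over the lamps [j] of
the squared increments of [sqrt m] when [j] is flipped. Since [sqrt (m s)] is
the quadratic mean of [g (., s)], such an increment is that of [g (j, .)] up to
the deviations of [g (j, .)] from its quadratic mean; the sum over [j] of these
deviations is again controlled by the Poincare inequality, with a factor [n]
and not [n ^ 2], because [j] is at the same time the lamp and the position.

Lower bound. Let [psi] be an eigenfunction for [gamma] such that the set [B]
where [psi <= 0] contains half of the vertices. Let [h] solve
[2 h - P h = g] with [g] the positive part of [psi]: it has the energy and the
norm of [g] up to constants, is small on [B], and is positive with bounded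
ratios along edges. The test function is [h i ^ 2] times a product of biased
densities for the lamps in [B]: its entropy is at least [c n] times the squared
norm of [h], whereas the walk only pays the energy of [h] and the flips only
the squared norm of [h] on [B].
*)

(** * Scalar inequalities *)

Section ScalarInequalities.
Context {R : realType}.
Implicit Types x y z a b c : R.

Lemma ln_le_subr1 x : 0 < x -> ln x <= x - 1.
Proof.
move=> x0; have -> : ln x = ln (1 + (x - 1)) by congr ln; lra.
by apply: le_ln1Dx; lra.
Qed.

Lemma ln_sub_le x y : 0 < x -> 0 < y -> ln x - ln y <= x / y - 1.
Proof.
by move=> x0 y0; rewrite -ln_div ?posrE//; apply: ln_le_subr1; rewrite divr_gt0.
Qed.

(** With [y] a mean, the linear term vanishes on summation and entropy is bounded by a chi-square
    distance. *)
Lemma xlnx_le x y : 0 < x -> 0 < y ->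
  x * ln x <= x * ln y + (x - y) + (x - y) ^+ 2 / y.
Proof.
move=> x0 y0; have := ln_sub_le x0 y0; rewrite -(ler_pM2l x0).
have -> : x * (x / y - 1) = x - y + (x - y) ^+ 2 / y by field; lra.
by rewrite mulrBr; lra.
Qed.

(** Tangent bound at [y] for the convex [x ln x]; summed around a mean it becomes Jensen's
    inequality. *)
Lemma xlnx_ge x y : 0 < x -> 0 < y -> x * ln y + (x - y) <= x * ln x.
Proof.
move=> x0 y0; have := ln_sub_le y0 x0; rewrite -(ler_pM2l x0).
have -> : x * (y / x - 1) = y - x by field; lra.
by rewrite mulrBr; lra.
Qed.

(** Lets the form of [f] against [ln f] dominate that of [sqrt f]. With [a = sqrt x >= b = sqrt y],
    the difference of logarithms is at least [2 (1 - b / a)], and [(a + b) / a >= 1]. *)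
Lemma mul_sub_ln_ge x y : 0 < x -> 0 < y ->
  2 * (Num.sqrt x - Num.sqrt y) ^+ 2 <= (x - y) * (ln x - ln y).
Proof.
wlog xy : x y / y <= x.
  move=> H x0 y0; have [yx|/ltW xy] := leP y x; first exact: H.
  by have := H _ _ xy y0 x0; lra.
move=> x0 y0; pose a : R := Num.sqrt x; pose b : R := Num.sqrt y; rewrite -/a -/b.
have a0 : 0 < a by rewrite sqrtr_gt0.
have b0 : 0 < b by rewrite sqrtr_gt0.
have ba : b <= a by rewrite ler_wsqrtr.
have -> : x = a ^+ 2 by rewrite sqr_sqrtr// ltW.
have -> : y = b ^+ 2 by rewrite sqr_sqrtr// ltW.
rewrite !lnXn//.
have h := ln_sub_le b0 a0.
clearbody a b.
apply: (@le_trans _ _ ((a ^+ 2 - b ^+ 2) * (2 * (1 - b / a)))); last first.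
  by apply: ler_wpM2l; [nra | rewrite !mulr2n; lra].
have -> : (a ^+ 2 - b ^+ 2) * (2 * (1 - b / a)) =
   2 * (a - b) ^+ 2 + 2 * ((a - b) ^+ 2 * b / a) by field; lra.
rewrite lerDl; apply: mulr_ge0 => //; apply: divr_ge0; last exact: ltW.
by apply: mulr_ge0; [exact: sqr_ge0 | exact: ltW].
Qed.

Lemma mul_sub_ln_le x y : 0 < y -> y <= x ->
  (x - y) * (ln x - ln y) <= (x - y) ^+ 2 / y.
Proof.
move=> y0 yx; have x0 : 0 < x by lra.
have -> : (x - y) ^+ 2 / y = (x - y) * (x / y - 1) by field; lra.
by apply: ler_wpM2l; [lra | exact: ln_sub_le].
Qed.

(** A reverse of [mul_sub_ln_ge], which fails for unbounded ratios [a / b]; hence the lower bound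
    wants a test function with bounded ratios along edges. *)
Lemma mul_sub_ln_sqr_le c a b : 0 < a -> 0 < b -> a <= c * b -> b <= c * a ->
  (a ^+ 2 - b ^+ 2) * (ln (a ^+ 2) - ln (b ^+ 2)) <= (c + 1) ^+ 2 * (a - b) ^+ 2.
Proof.
wlog ba : a b / b <= a.
  move=> H a0 b0 ab ba'; have [ba|/ltW ab'] := leP b a; first exact: H.
  by have := H _ _ ab' b0 a0 ba' ab; lra.
move=> a0 b0 ac _.
have b20 : 0 < b ^+ 2 by rewrite exprn_gt0.
apply: le_trans (mul_sub_ln_le b20 _) _; first nra.
rewrite ler_pdivrMr//.
have -> : (a ^+ 2 - b ^+ 2) ^+ 2 = (a - b) ^+ 2 * (a + b) ^+ 2 by ring.
rewrite [leRHS](_ : _ = (a - b) ^+ 2 * ((c + 1) * b) ^+ 2); last by ring.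
apply: ler_wpM2l; first exact: sqr_ge0.
by rewrite ler_sqr ?nnegrE; nra.
Qed.

(** Log-Sobolev inequality on two points: [xlnx_le] around the mean [m], where the linear terms
    cancel. *)
Lemma two_point_entropy_le a b : 0 < a -> 0 < b ->
  a * ln a + b * ln b <=
  (a + b) * ln (2^-1 * (a + b)) + 2 * (Num.sqrt a - Num.sqrt b) ^+ 2.
Proof.
move=> a0 b0; set m := 2^-1 * (a + b).
have m0 : 0 < m by rewrite /m; lra.
have h : (a - m) ^+ 2 / m + (b - m) ^+ 2 / m
    <= 2 * (Num.sqrt a - Num.sqrt b) ^+ 2.
  rewrite -mulrDl ler_pdivrMr// /m.
  pose s : R := Num.sqrt a; pose t : R := Num.sqrt b; rewrite -/s -/t.
  have -> : a = s ^+ 2 by rewrite sqr_sqrtr// ltW.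
  have -> : b = t ^+ 2 by rewrite sqr_sqrtr// ltW.
  clearbody s t; have -> : (s ^+ 2 - 2^-1 * (s ^+ 2 + t ^+ 2)) ^+ 2 +
     (t ^+ 2 - 2^-1 * (s ^+ 2 + t ^+ 2)) ^+ 2 =
     (s - t) ^+ 2 * (2^-1 * (s + t) ^+ 2) by field.
  rewrite [leRHS](_ : _ = (s - t) ^+ 2 * (s ^+ 2 + t ^+ 2)); last by field.
  apply: ler_wpM2l; first exact: sqr_ge0.
  by have := sqr_ge0 (s - t); nra.
have := xlnx_le a0 m0; have := xlnx_le b0 m0.
have : a * ln m + b * ln m = (a + b) * ln m by ring.
have : a - m + (b - m) = 0 by rewrite /m; field.
by lra.
Qed.

(* Convexity of [(x, y) |-> (sqrt x - sqrt y) ^ 2], by Cauchy-Schwarz. *)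
Lemma sqr_sub_sqrt_mid_le a b c d : 0 <= a -> 0 <= b -> 0 <= c -> 0 <= d ->
  (Num.sqrt (2^-1 * (a + b)) - Num.sqrt (2^-1 * (c + d))) ^+ 2 <=
  2^-1 * ((Num.sqrt a - Num.sqrt c) ^+ 2 + (Num.sqrt b - Num.sqrt d) ^+ 2).
Proof.
move=> a0 b0 c0 d0.
pose s : R := Num.sqrt a; pose t : R := Num.sqrt b.
pose u : R := Num.sqrt c; pose v : R := Num.sqrt d.
pose p : R := Num.sqrt (2^-1 * (a + b)); pose q : R := Num.sqrt (2^-1 * (c + d)).
have s0 : 0 <= s by exact: sqrtr_ge0. have t0 : 0 <= t by exact: sqrtr_ge0.
have u0 : 0 <= u by exact: sqrtr_ge0. have v0 : 0 <= v by exact: sqrtr_ge0.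
have p0 : 0 <= p by exact: sqrtr_ge0. have q0 : 0 <= q by exact: sqrtr_ge0.
have pE : p ^+ 2 = 2^-1 * (s ^+ 2 + t ^+ 2) by rewrite !sqr_sqrtr//; lra.
have qE : q ^+ 2 = 2^-1 * (u ^+ 2 + v ^+ 2) by rewrite !sqr_sqrtr//; lra.
rewrite -/p -/q -/s -/t -/u -/v.
clearbody s t u v p q.
suff : s * u + t * v <= 2 * (p * q).
  have : (p - q) ^+ 2 = p ^+ 2 + q ^+ 2 - 2 * (p * q) by ring.
  by rewrite pE qE; lra.
rewrite -ler_sqr ?nnegrE ?addr_ge0 ?mulr_ge0//.
have -> : (2 * (p * q)) ^+ 2 = 4 * (p ^+ 2 * q ^+ 2) by ring.
rewrite pE qE; have := sqr_ge0 (s * v - t * u); lra.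
Qed.

End ScalarInequalities.

(** * Energy of a graph and its spectral gap *)

Section GraphEnergy.
Context {R : realType} {V : finType} (e : rel V).
Implicit Types x y : V -> R.

Definition lap x i : R := \sum_(j | e i j) (x i - x j).

Definition energy x y : R :=
  2^-1 * \sum_i \sum_(j | e i j) (x i - x j) * (y i - y j).

Definition volume : R := \sum_i (deg e i)%:R.

Definition dnorm2 x : R := \sum_i (deg e i)%:R * x i ^+ 2.

Definition dsum x : R := \sum_i (deg e i)%:R * x i.

Lemma sum_edge_swap (F : V -> V -> R) : symmetric e ->
  \sum_i \sum_(j | e i j) F i j = \sum_i \sum_(j | e i j) F j i.
Proof.
move=> se; rewrite (exchange_big_dep xpredT)//=; apply: eq_bigr => i _.
by apply: eq_bigl => j; rewrite se.
Qed.

(** Discrete Green formula: each edge is counted from both ends. *)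
Lemma sum_mul_lap x y : symmetric e -> \sum_i y i * lap x i = energy x y.
Proof.
move=> se; have h : \sum_i y i * lap x i =
    \sum_i \sum_(j | e i j) y i * (x i - x j).
  by apply: eq_bigr => i _; rewrite mulr_sumr.
rewrite /energy; suff : \sum_i \sum_(j | e i j) (x i - x j) * (y i - y j)
   = 2 * \sum_i y i * lap x i by move=> ->; rewrite mulrA mulVf ?mul1r.
rewrite mulr2n mulrDl mul1r [in X in X + _]h h [X in _ = _ + X]sum_edge_swap//.
rewrite -big_split/=; apply: eq_bigr => i _.
by rewrite -big_split/=; apply: eq_bigr => j _; ring.
Qed.

Lemma energyC x y : energy x y = energy y x.
Proof.
by congr (_ * _); apply: eq_bigr => i _; apply: eq_bigr => j _; rewrite mulrC.
Qed.

Lemma energy_ge0 x : 0 <= energy x x.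
Proof.
rewrite mulr_ge0 ?invr_ge0//; apply: sumr_ge0 => i _; apply: sumr_ge0 => j _.
by rewrite -expr2 sqr_ge0.
Qed.

Lemma energyDl x y z : energy (fun i => x i + y i) z = energy x z + energy y z.
Proof.
rewrite -mulrDr -big_split/=; congr (_ * _); apply: eq_bigr => i _.
by rewrite -big_split/=; apply: eq_bigr => j _; ring.
Qed.

Lemma energyZl c x z : energy (fun i => c * x i) z = c * energy x z.
Proof.
rewrite mulrCA; congr (_ * _); rewrite mulr_sumr; apply: eq_bigr => i _.
by rewrite mulr_sumr; apply: eq_bigr => j _; ring.
Qed.

Lemma energy_cst c z : energy (fun=> c) z = 0.
Proof.
rewrite /energy big1 ?mulr0// => i _; rewrite big1// => j _.
by rewrite subrr mul0r.
Qed.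

Lemma natr_deg i : (deg e i)%:R = \sum_(j | e i j) 1 :> R.
Proof. by rewrite sumr_const /deg cardsE. Qed.

Lemma sum_edge_const c i : \sum_(j | e i j) c = (deg e i)%:R * c :> R.
Proof. by rewrite natr_deg mulr_suml; apply: eq_bigr => j _; rewrite mul1r. Qed.

Lemma dnorm2_ge0 x : 0 <= dnorm2 x.
Proof. by apply: sumr_ge0 => i _; rewrite mulr_ge0 ?sqr_ge0. Qed.

Lemma deg_gt0 i : connected_graph e -> (2 <= #|V|)%N -> (0 < deg e i)%N.
Proof.
move=> ce V2; have [j ji] : exists j, j != i.
  apply/existsP; apply: contraLR V2 => /existsPn h; rewrite -ltnNge ltnS.
  apply/card_le1P => x _ y; rewrite !inE.
  by rewrite (eqP (negPn (h x))) (eqP (negPn (h y))) eqxx.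
have /connectP[[|k p] /=] := ce i j; first by move=> _ eji; rewrite eji eqxx in ji.
by move=> /andP[eik _] _; apply/card_gt0P; exists k; rewrite inE.
Qed.

Lemma energy_eq0 x : symmetric e -> connected_graph e -> energy x x = 0 ->
  forall i j, x i = x j.
Proof.
move=> se ce /eqP; rewrite mulf_eq0 invr_eq0 pnatr_eq0/= => h.
have q i j : 0 <= (x i - x j) * (x i - x j) by rewrite -expr2 sqr_ge0.
have h1 i j : e i j -> x i = x j.
  move=> eij; move: h; rewrite psumr_eq0; last by move=> *; exact: sumr_ge0.
  move=> /allP/(_ i (mem_index_enum _))/=; rewrite psumr_eq0//.
  move=> /allP/(_ j (mem_index_enum _))/implyP/(_ eij).
  by rewrite mulf_eq0 orbb subr_eq0 => /eqP.
move=> i j; have /connectP[p] := ce i j.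
elim: p i => [i _ -> //|k p IH i /= /andP[eik pth] lst].
by rewrite (h1 _ _ eik); exact: IH.
Qed.

(** By reversibility, multiplying a function by [deg] turns it into a row vector on which the left
    action of I - P is [lap]. *)
Lemma row_srw x (degp : forall i, (0 < deg e i)%N) : symmetric e ->
  (\row_a ((deg e (enum_val a))%:R * x (enum_val a)))
    *m (1%:M - srw_matrix R e) = \row_b lap x (enum_val b).
Proof.
move=> se; apply/rowP => b; rewrite mulmxBr mulmx1 !mxE /lap.
rewrite sumrB sum_edge_const; congr (_ - _).
rewrite [RHS]big_mkcond/= [RHS](reindex (@enum_val V xpredT))/=; last first.
  by apply: onW_bij; exact: enum_val_bij.
apply: eq_bigr => a _; rewrite !mxE se.
case: ifP; rewrite /= ?mulr0// mulr1 mulrAC mulfV ?mul1r//.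
by rewrite pnatr_eq0 -lt0n.
Qed.

Lemma eigenvalue_lapP (degp : forall i, (0 < deg e i)%N) a : symmetric e ->
  eigenvalue (1%:M - srw_matrix R e) a <->
  exists x, (exists i, x i != 0) /\
    forall i, lap x i = a * ((deg e i)%:R * x i).
Proof.
have dn0 i : (deg e i)%:R != 0 :> R by rewrite pnatr_eq0 -lt0n.
move=> se; split.
  move=> /eigenvalueP[v va v0].
  pose x i := v 0 (enum_rank i) / (deg e i)%:R.
  have vE : v = \row_a ((deg e (enum_val a))%:R * x (enum_val a)).
    by apply/rowP => b; rewrite mxE /x enum_valK mulrC divfK.
  exists x; split.
    apply: contrapT => /forallNP h; case/eqP: v0; rewrite vE.
    apply/rowP => b; rewrite !mxE.
    by have /negP/negPn/eqP -> := h (enum_val b); rewrite mulr0.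
  move=> i; move: va; rewrite {1}vE row_srw// => /rowP/(_ (enum_rank i)).
  by rewrite mxE enum_rankK => ->; rewrite mxE {1}vE !mxE enum_rankK.
move=> [x [[i xi0] xE]]; apply/eigenvalueP.
exists (\row_a ((deg e (enum_val a))%:R * x (enum_val a))).
  by rewrite row_srw//; apply/rowP => b; rewrite !mxE xE.
apply: contraNneq xi0 => /rowP/(_ (enum_rank i)); rewrite !mxE enum_rankK.
by move=> /eqP; rewrite mulf_eq0 (negPf (dn0 i)).
Qed.

End GraphEnergy.

(** First-order condition: at [t = - b / c] with [c = |k| + 1], the value is at most
    [- b ^ 2 / c]. *)
Lemma quadratic_ge0_linear_coef (R : realFieldType) (b k : R) :
  (forall t, 0 <= 2 * t * b + t ^+ 2 * k) -> b = 0.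
Proof.
move=> h; pose c := `|k| + 1.
have c0 : 0 < c by rewrite /c ltr_wpDl.
have kc : k <= c by rewrite /c (le_trans (ler_norm k))// lerDl.
have := h (- (b / c)).
have -> : 2 * - (b / c) * b + (- (b / c)) ^+ 2 * k = (b / c) ^+ 2 * (k - 2 * c).
  by field; rewrite gt_eqF.
have bc : 0 <= (b / c) ^+ 2 by exact: sqr_ge0.
move=> h1; have : (b / c) ^+ 2 = 0 by nra.
by move/eqP; rewrite sqrf_eq0 mulf_eq0 invr_eq0 (gt_eqF c0) orbF => /eqP.
Qed.

(** * Variational form of the gap, Poincare inequality and resolvent *)

Section Poincare.
Import numFieldNormedType.Exports.
Local Open Scope classical_set_scope.
Context {R : realType} {V : finType} (e : rel V).
Context (se : symmetric e) (ce : connected_graph e) (V2 : (2 <= #|V|)%N).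
Implicit Types x y : V -> R.

Let dn i : R := (deg e i)%:R.

Lemma degr_ge1 i : 1 <= dn i.
Proof. by rewrite ler1n deg_gt0. Qed.

Lemma degr_gt0 i : 0 < dn i.
Proof. by rewrite ltr0n deg_gt0. Qed.

Lemma energyDZ x y t :
  energy e (fun i => x i + t * y i) (fun i => x i + t * y i) =
  energy e x x + 2 * t * energy e x y + t ^+ 2 * energy e y y.
Proof.
rewrite energyDl energyZl energyC energyDl energyZl.
rewrite [X in _ + t * X]energyC energyDl energyZl (energyC e y x).
by ring.
Qed.

Lemma dnorm2DZ x y t : dnorm2 e (fun i => x i + t * y i) =
  dnorm2 e x + 2 * t * (\sum_i dn i * x i * y i) + t ^+ 2 * dnorm2 e y.
Proof.
rewrite /dnorm2 !mulr_sumr -!big_split/=.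
by apply: eq_bigr => i _; rewrite /dn; ring.
Qed.

(** The centred functions of norm 1 form a nonempty compact set, on which the continuous energy
    attains its minimum. *)
Lemma energy_minimizer : exists x, [/\ dsum e x = 0, dnorm2 e x = 1 &
  forall y, dsum e y = 0 -> dnorm2 e y = 1 -> energy e x x <= energy e y y].
Proof.
pose of_rV (v : 'rV[R]_#|V|) i : R := v 0 (enum_rank i).
have of_rVE x : of_rV (\row_a x (enum_val a)) = x.
  by apply/funext => i; rewrite /of_rV mxE enum_rankK.
have c_coord i : continuous (of_rV ^~ i) by exact: coord_continuous.
have c_sum (I : finType) (P : pred I) (F : I -> 'rV[R]_#|V| -> R) :
    (forall i, continuous (F i)) -> continuous (fun v => \sum_(i | P i) F i v).
  move=> cF; apply: continuous_big => //; exact: add_continuous.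
have c_mul (f g : 'rV[R]_#|V| -> R) :
    continuous f -> continuous g -> continuous (fun v => f v * g v).
  by move=> cf cg v; exact: (@cvgM R _ _ _ f g _ _ (cf v) (cg v)).
have c_sub i j : continuous (fun v => of_rV v i - of_rV v j).
  by move=> v; exact: (@cvgB R _ _ _ _ (of_rV ^~ i) (of_rV ^~ j) _ _
    (c_coord i v) (c_coord j v)).
have c_cst (c : R) : continuous (fun _ : 'rV[R]_#|V| => c).
  exact: cst_continuous.
have c_dsum : continuous (fun v => dsum e (of_rV v)).
  by apply: (c_sum _ _ (fun i v => dn i * of_rV v i)) => i; exact: c_mul.
have c_dnorm2 : continuous (fun v => dnorm2 e (of_rV v)).
  apply: (c_sum _ _ (fun i v => dn i * of_rV v i ^+ 2)) => i.
  by apply: (c_mul) => //; exact: c_mul.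
have c_energy : continuous (fun v => energy e (of_rV v) (of_rV v)).
  apply: (c_mul) => //; apply: (c_sum _ _ (fun i v => \sum_(j | e i j) _)) => i.
  by apply: (c_sum) => j; exact: c_mul.
pose S := [set v | dsum e (of_rV v) = 0] `&` [set v | dnorm2 e (of_rV v) = 1].
have S0 : S !=set0.
  have /card_gt1P[i [j [_ _ ij]]] := V2.
  (* Opposite masses at two vertices, divided by the degrees so that [dsum] vanishes. *)
  pose x k := (k == i)%:R / dn i - (k == j)%:R / dn j.
  have x0 : dsum e x = 0.
    rewrite /dsum /x (bigD1 i)//= (bigD1 j)/=; last by rewrite eq_sym.
    rewrite big1 => [|k /andP[/negPf ki /negPf kj]].
      rewrite !eqxx (negPf ij) eq_sym (negPf ij) !mul0r subr0 sub0r addr0.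
      by rewrite mulrN !mul1r !mulfV ?subrr// gt_eqF// degr_gt0.
    by rewrite ki kj !mul0r subrr mulr0.
  have xp : 0 < dnorm2 e x.
    rewrite lt_neqAle dnorm2_ge0 andbT eq_sym; apply/eqP.
    move=> /eqP; rewrite psumr_eq0; last by move=> *; rewrite mulr_ge0 ?sqr_ge0.
    move=> /allP/(_ i (mem_index_enum _))/=.
    rewrite mulf_eq0 (gt_eqF (degr_gt0 i))/= /x eqxx (negPf ij) mul0r subr0.
    by rewrite sqrf_eq0 mul1r invr_eq0 (gt_eqF (degr_gt0 i)).
  exists (\row_a (x (enum_val a) / Num.sqrt (dnorm2 e x))).
  rewrite /S /= (of_rVE (fun i => x i / _)); split.
    rewrite /dsum (eq_bigr (fun i => dn i * x i / Num.sqrt (dnorm2 e x))).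
      by rewrite -mulr_suml -/(dsum e x) x0 mul0r.
    by move=> k _; rewrite mulrA.
  rewrite {1}/dnorm2 (eq_bigr (fun i => dn i * x i ^+ 2 / dnorm2 e x)).
    by rewrite -mulr_suml mulfV// gt_eqF.
  by move=> k _; rewrite exprMn exprVn sqr_sqrtr ?dnorm2_ge0// mulrA.
have cS : compact S.
  apply: bounded_closed_compact.
    (* Degrees are at least 1, so every squared coordinate is at most [dnorm2], that is 1. *)
    exists 1; split; first by rewrite num_real.
    move=> M M1 v [_ v1]; rewrite /Num.norm/= mx_normrE.
    apply: bigmax_le => [|[i a] _ /=]; first by rewrite (le_trans _ (ltW M1)).
    rewrite (ord1 i) (le_trans _ (ltW M1))// -(@ler_sqr R) ?nnegrE//.
    rewrite expr1n real_normK ?num_real// -v1 /dnorm2.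
    rewrite (bigD1 (enum_val a))//= /of_rV enum_valK.
    rewrite -[X in X <= _]addr0 lerD//; last first.
      by apply: sumr_ge0 => j _; rewrite mulr_ge0 ?sqr_ge0.
    by rewrite ler_peMl ?sqr_ge0 ?degr_ge1.
  apply: closedI.
    apply: ((continuous_closedP _).1 c_dsum [set x | x = 0]).
    exact: closed_eq.
  apply: ((continuous_closedP _).1 c_dnorm2 [set x | x = 1]).
  exact: closed_eq.
have [|v vS vmin] := EVT_min_rV S0 cS (f := fun v => energy e (of_rV v) (of_rV v)).
  exact: continuous_subspaceT.
exists (of_rV v); move: vS; rewrite inE => -[v0 v1]; split=> // y y0 y1.
have := vmin (\row_a y (enum_val a)); rewrite of_rVE; apply.
by rewrite inE /S/= of_rVE.
Qed.

Lemma eigenfunction_energy lam x :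
  (forall i, lap e x i = lam * (dn i * x i)) -> energy e x x = lam * dnorm2 e x.
Proof.
move=> xE; rewrite -sum_mul_lap// mulr_sumr; apply: eq_bigr => i _.
by rewrite xE; rewrite /dn; ring.
Qed.

Lemma eigenfunction_dsum lam x : lam != 0 ->
  (forall i, lap e x i = lam * (dn i * x i)) -> dsum e x = 0.
Proof.
move=> lam0 xE; have := sum_mul_lap x (fun=> 1) se.
rewrite energyC energy_cst (eq_bigr (fun i => lam * (dn i * x i))); last first.
  by move=> i _; rewrite mul1r xE.
by rewrite -mulr_sumr => /eqP; rewrite mulf_eq0 (negPf lam0) => /eqP.
Qed.

Lemma dnorm2_gt0 x i : x i != 0 -> 0 < dnorm2 e x.
Proof.
move=> xi0; rewrite /dnorm2 (bigD1 i)//= ltr_wpDr//.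
  by apply: sumr_ge0 => j _; rewrite mulr_ge0 ?sqr_ge0.
by rewrite mulr_gt0 ?degr_gt0// exprn_even_gt0.
Qed.

(** The constrained minimiser of the energy is an eigenfunction, because the first variation
    vanishes in every centred direction. *)
Lemma min_eigenfunction : exists lam x, [/\ 0 < lam, exists i, x i != 0,
  forall i, lap e x i = lam * (dn i * x i) &
  forall y, dsum e y = 0 -> lam * dnorm2 e y <= energy e y y].
Proof.
have [x [x0 x1 xmin]] := energy_minimizer.
pose lam := energy e x x.
have lamP y : dsum e y = 0 -> lam * dnorm2 e y <= energy e y y.
  move=> y0; have [n0|n0] := eqVneq (dnorm2 e y) 0.
    by rewrite n0 mulr0 energy_ge0.
  have np : 0 < dnorm2 e y by rewrite lt_neqAle eq_sym n0 dnorm2_ge0.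
  pose c := (Num.sqrt (dnorm2 e y))^-1.
  have c2 : c ^+ 2 = (dnorm2 e y)^-1 by rewrite exprVn sqr_sqrtr// ltW.
  have := xmin (fun i => c * y i); rewrite energyZl energyC energyZl => h.
  rewrite -ler_pdivlMr// mulrC -c2 expr2 -mulrA h//.
    rewrite -[RHS](mulr0 c) -[X in _ = _ * X]y0 /dsum mulr_sumr.
    by apply: eq_bigr => i _; rewrite mulrCA.
  have -> : 1 = c ^+ 2 * dnorm2 e y by rewrite c2 mulVf.
  by rewrite /dnorm2 mulr_sumr; apply: eq_bigr => i _; rewrite exprMn mulrCA.
have [i xi0] : exists i, x i != 0.
  apply: contrapT => /forallNP h; have : dnorm2 e x = 0.
    rewrite /dnorm2 big1// => i _.
    by have /negP/negPn/eqP -> := h i; rewrite expr0n mulr0.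
  by rewrite x1 => /eqP; rewrite oner_eq0.
exists lam, x; split=> //.
- rewrite lt_neqAle energy_ge0 andbT eq_sym; apply/eqP => /(energy_eq0 se ce) xc.
  move: x0; rewrite /dsum (eq_bigr (fun j => dn j * x i)).
    rewrite -mulr_suml => /eqP; rewrite mulf_eq0 (negPf xi0) orbF.
    rewrite psumr_eq0 => [/allP/(_ i (mem_index_enum _))/=|//].
    by rewrite (gt_eqF (degr_gt0 i)).
  by move=> j _; rewrite (xc j i).
- by exists i.
(* The residual [r] of the eigenvalue equation sums to zero, so [r / dn] is a centred direction; the
   first variation along it is the sum of [r ^ 2 / dn]. *)
pose r j := lap e x j - lam * (dn j * x j).
have r_sum : \sum_j r j = 0.
  rewrite sumrB -mulr_sumr -/(dsum e x) x0 mulr0 subr0.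
  have := sum_mul_lap x (fun=> 1) se; rewrite energyC energy_cst => h.
  rewrite -[RHS]h; by apply: eq_bigr => j _; rewrite mul1r.
pose phi j := r j / dn j.
have phi0 : dsum e phi = 0.
  rewrite -[RHS]r_sum; apply: eq_bigr => j _; rewrite /phi mulrC divfK//.
  by rewrite gt_eqF// degr_gt0.
have /eqP : energy e x phi - lam * (\sum_i dn i * x i * phi i) = 0.
  apply: (@quadratic_ge0_linear_coef _ _ (energy e phi phi - lam * dnorm2 e phi)).
  move=> t; have := lamP (fun j => x j + t * phi j).
  rewrite energyDZ dnorm2DZ x1 -/lam => /(_ _)/[dup] h.
  have : dsum e (fun j => x j + t * phi j) = 0.
    rewrite /dsum (eq_bigr (fun j => dn j * x j + t * (dn j * phi j))).
      by rewrite big_split/= -mulr_sumr -/(dsum e x) -/(dsum e phi) x0 phi0 mulr0 addr0.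
    by move=> j _; rewrite /dn; ring.
  by move=> /h; lra.
rewrite -sum_mul_lap// mulr_sumr -sumrB (eq_bigr (fun j => r j ^+ 2 / dn j)).
  rewrite psumr_eq0 => [/allP rE j|j _]; last first.
    by rewrite divr_ge0 ?sqr_ge0.
  apply/eqP; rewrite -subr_eq0 -/(r j).
  have := rE j (mem_index_enum _); rewrite /= mulf_eq0 invr_eq0.
  by rewrite (gt_eqF (degr_gt0 j)) orbF sqrf_eq0.
by move=> j _; rewrite /phi /r; field; rewrite gt_eqF// degr_gt0.
Qed.

Let degp i : (0 < deg e i)%N. Proof. exact: deg_gt0. Qed.

Lemma spectral_gap_eigenvalue :
  nonzero_eigenvalues R e (spectral_gap R e) /\
  lbound (nonzero_eigenvalues R e) (spectral_gap R e).
Proof.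
have [lam [x [lam0 xn0 xE _]]] := min_eigenfunction.
apply: spectral_gap_min; exists lam; split; last by rewrite gt_eqF.
by apply/(eigenvalue_lapP degp _ se); exists x.
Qed.

Lemma spectral_gap_eigenfunction : exists x, (exists i, x i != 0) /\
  forall i, lap e x i = spectral_gap R e * (dn i * x i).
Proof.
by have [[/(eigenvalue_lapP degp _ se)]] := spectral_gap_eigenvalue.
Qed.

Lemma spectral_gap_gt0 : 0 < spectral_gap R e.
Proof.
have [[_ g0] _] := spectral_gap_eigenvalue.
have [x [[i xi0] xE]] := spectral_gap_eigenfunction.
have := energy_ge0 e x; rewrite (eigenfunction_energy xE).
by rewrite pmulr_lge0 ?(dnorm2_gt0 xi0)// lt_neqAle eq_sym g0.
Qed.

(** The minimal energy [lam] is a nonzero eigenvalue, hence at least the gap; its inequality is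
    applied to [y] minus its mean. *)
Lemma spectral_gap_poincare y :
  spectral_gap R e * (dnorm2 e y - dsum e y ^+ 2 / volume e) <= energy e y y.
Proof.
have [lam [x [lam0 xn0 xE lamP]]] := min_eigenfunction.
have lg : spectral_gap R e <= lam.
  apply: spectral_gap_eigenvalue.2; split; last by rewrite gt_eqF.
  by apply/(eigenvalue_lapP degp _ se); exists x.
have vol0 : 0 < volume e :> R.
  have [i _] := xn0; rewrite /volume (bigD1 i)//= ltr_wpDr ?degr_gt0//.
  by apply: sumr_ge0.
pose m := dsum e y / volume e.
pose z i := y i + - m.
have z0 : dsum e z = 0.
  rewrite /dsum (eq_bigr (fun i => dn i * y i + dn i * - m)); last first.
    by move=> i _; rewrite mulrDr.
  rewrite big_split/= -mulr_suml -/(dsum e y) -/(volume e) /m mulrN mulrC divfK ?subrr//.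
  by rewrite gt_eqF.
have nz : dnorm2 e z = dnorm2 e y - dsum e y ^+ 2 / volume e.
  rewrite /dnorm2 (eq_bigr (fun i => dn i * y i ^+ 2 - 2 * m * (dn i * y i)
     + m ^+ 2 * dn i)); last by move=> i _; rewrite /z /dn; ring.
  rewrite big_split/= sumrB -!mulr_sumr -/(dsum e y) -/(volume e) /m.
  by field; rewrite gt_eqF.
have ez : energy e z z = energy e y y.
  by rewrite energyDl energy_cst addr0 energyC energyDl energy_cst addr0.
rewrite -nz -ez (le_trans _ (lamP z z0))// ler_wpM2r//.
exact: dnorm2_ge0.
Qed.

(** The eigenvalue equation is read at a vertex where [|x|] is maximal. *)
Lemma spectral_gap_le2 : spectral_gap R e <= 2.
Proof.
have [x [[i0 xi0] xE]] := spectral_gap_eigenfunction.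
have [i _ imax] := @arg_maxP _ _ _ i0 xpredT (fun j => `|x j|) isT.
have {}imax j : `|x j| <= `|x i| by exact: imax.
have xi : 0 < `|x i| by rewrite (lt_le_trans _ (imax i0))// normr_gt0.
have g0 := spectral_gap_gt0.
have : `|lap e x i| <= dn i * (2 * `|x i|).
  rewrite (le_trans (ler_norm_sum _ _ _))// /dn -sum_edge_const ler_sum// => j _.
  by rewrite (le_trans (ler_normB _ _))// mulr2n mulrDl !mul1r lerD// imax.
rewrite xE !normrM (ger0_norm (ltW g0)) (ger0_norm (ltW (degr_gt0 i))).
rewrite mulrCA ler_pM2l ?degr_gt0// ler_pM2r//.
Qed.

(* [-1] is not an eigenvalue of [I - P], so [2 I - P] is invertible. *)
Lemma resolvent_exists y : exists h : V -> R,
  forall i, lap e h i + dn i * h i = dn i * y i.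
Proof.
pose M := 1%:M - srw_matrix R e.
have nev : ~~ eigenvalue M (-1).
  apply/negP => /(eigenvalue_lapP degp _ se)[x [[i xi0] xE]].
  have := energy_ge0 e x; rewrite (eigenfunction_energy xE).
  by have := dnorm2_gt0 xi0; lra.
have Mu : M - (-1)%:M \in unitmx.
  rewrite -row_free_unit -kermx_eq0.
  by move: nev; rewrite /eigenvalue /eigenspace negbK.
pose w : 'rV[R]_#|V| := \row_(a < #|V|) (dn (enum_val a) * y (enum_val a)).
have [v vw] : exists v, v *m (M - (-1)%:M) = w.
  by exists (w *m invmx (M - (-1)%:M)); rewrite mulmxKV.
pose h i := v 0 (enum_rank i) / dn i.
have vE : v = \row_a (dn (enum_val a) * h (enum_val a)).
  by apply/rowP => b; rewrite mxE /h enum_valK mulrC divfK// gt_eqF// degr_gt0.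
exists h => i; move: vw; rewrite {1}vE mulmxBr row_srw// mul_mx_scalar scaleN1r.
by move=> /rowP/(_ (enum_rank i)); rewrite !mxE !enum_rankK opprK.
Qed.

End Poincare.

(** * Entropy on the hypercube *)

Section Hypercube.
Context {R : realType} {V : finType}.
Implicit Types (s t : {ffun V -> bool}) (m : {ffun V -> bool} -> R) (i j : V).

Lemma flipK j : involutive (@flip V j).
Proof.
by move=> s; apply/ffunP => v; rewrite !ffunE; case: eqP => // _; rewrite negbK.
Qed.

Lemma flipC i j s : flip i (flip j s) = flip j (flip i s).
Proof. by apply/ffunP => v; rewrite !ffunE; do 2![case: eqP]. Qed.

Lemma sum_flip j m : \sum_s m (flip j s) = \sum_s m s.
Proof. by rewrite [RHS](reindex_inj (inv_inj (flipK j))). Qed.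

(** Coordinates pass from [s] to [t] one at a time, each change being trivial or a flip. *)
Lemma flip_invariant_const m : (forall j s, m (flip j s) = m s) ->
  forall s t, m s = m t.
Proof.
move=> h s t.
suff hl (l : seq V) : m [ffun v => if v \in l then t v else s v] = m s.
  rewrite -(hl (enum V)); congr m.
  by apply/ffunP => v; rewrite ffunE mem_enum.
elim: l => [|j l IH]; first by congr m; apply/ffunP => v; rewrite ffunE.
rewrite -IH; set u := [ffun v => if v \in l then _ else _].
have [uj|uj] := eqVneq (u j) (t j).
  congr m; apply/ffunP => v; rewrite [LHS]ffunE inE.
  by case: eqP => [->|_] /=; rewrite ?uj// /u ffunE.
rewrite -(h j u); congr m; apply/ffunP => v; rewrite !ffunE inE.
case: eqP => [->|_] //=; move: uj; rewrite /u ffunE.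
by case: ifP => _; case: (t j); case: (s j).
Qed.

(** Conditional expectation, under the uniform measure, given all lamps but [j]. *)
Definition avg j m s : R := 2^-1 * (m s + m (flip j s)).

Definition sqrt_form j m : R :=
  \sum_s (Num.sqrt (m s) - Num.sqrt (m (flip j s))) ^+ 2.

Lemma sum_avg j m : \sum_s avg j m s = \sum_s m s.
Proof.
by rewrite -mulr_sumr big_split/= sum_flip; lra.
Qed.

(** Flips commute, and the squared difference of square roots is convex in the pair of values. *)
Lemma sqrt_form_avg i j m : (forall s, 0 <= m s) ->
  sqrt_form j (avg i m) <= sqrt_form j m.
Proof.
move=> m0; rewrite -[leRHS](sum_avg i); apply: ler_sum => s _.
rewrite /avg (flipC i j s); exact: sqr_sub_sqrt_mid_le.
Qed.

Lemma entropy_avg j m : (forall s, 0 < m s) ->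
  \sum_s m s * ln (m s) <=
  \sum_s avg j m s * ln (avg j m s) + sqrt_form j m.
Proof.
move=> m0; rewrite -(sum_avg j (fun s => m s * ln (m s))) -big_split/=.
apply: ler_sum => s _; rewrite /avg.
by have := two_point_entropy_le (m0 s) (m0 (flip j s)); lra.
Qed.

(** Tensorisation: the lamps of [l] are averaged in turn. Each averaging costs the form of the
    current function, which the earlier ones did not increase, so the forms of [m] bound the total
    cost. *)
Lemma iterated_avg m (l : seq V) : (forall s, 0 < m s) ->
  exists m' : {ffun V -> bool} -> R,
  [/\ forall s, 0 < m' s, \sum_s m' s = \sum_s m s,
      forall j, j \in l -> forall s, m' (flip j s) = m' s,
      forall j, sqrt_form j m' <= sqrt_form j m &
      \sum_s m s * ln (m s) <=
      \sum_s m' s * ln (m' s) + \sum_(j <- l) sqrt_form j m].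
Proof.
move=> m0; elim: l => [|i l [m' [m'0 m'S m'I m'T m'E]]].
  by exists m; split=> //; rewrite big_nil addr0.
exists (avg i m'); split=> [s|||j|].
- by rewrite mulr_gt0 ?invr_gt0 ?addr_gt0.
- by rewrite sum_avg.
- move=> j; rewrite inE /avg => /predU1P[-> s|jl s].
    by rewrite flipK addrC.
  by rewrite (flipC i j) !(m'I j).
- by rewrite (le_trans _ (m'T j))// sqrt_form_avg// => s; exact: ltW.
- rewrite big_cons; have := entropy_avg i m'0; have := m'T i; lra.
Qed.

(** Once every lamp is averaged, the function is constant and equals the mean of [m]. *)
Lemma hypercube_entropy_le m : (forall s, 0 < m s) ->
  \sum_s m s * ln (m s) <=
  (\sum_s m s) * ln ((\sum_s m s) / #|{ffun V -> bool}|%:R)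
  + \sum_j sqrt_form j m.
Proof.
move=> /(@iterated_avg _ (index_enum V))[m' [m'0 <- m'I _ m'E]].
have m'c := flip_invariant_const (fun j => m'I j (mem_index_enum j)).
pose s0 : {ffun V -> bool} := [ffun=> false].
apply: le_trans m'E _; rewrite lerD2r.
have m'S : \sum_s m' s = #|{ffun V -> bool}|%:R * m' s0.
  rewrite (eq_bigr (fun=> m' s0)); last by move=> s _; exact: m'c.
  by rewrite sumr_const mulr_natl.
have N0 : #|{ffun V -> bool}|%:R != 0 :> R.
  by rewrite pnatr_eq0 -lt0n; apply/card_gt0P; exists s0.
rewrite {2}m'S [_ * m' s0]mulrC mulfK// mulr_suml ler_sum// => s _.
by rewrite (m'c s s0).
Qed.

End Hypercube.

(** * Upper bound *)

Section LampForms.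
Context {R : realType} {V : finType} (e : rel V).
Implicit Types f g phi : lamp_state V -> R.

Let dn i : R := (deg e i)%:R.

Definition lamp_volume : R := \sum_(y : lamp_state V) (deg e y.1)%:R.

Lemma sum_lamp phi : \sum_x phi x = \sum_s \sum_i phi (i, s).
Proof.
by rewrite exchange_big/= pair_bigA/=; apply: eq_bigr => -[].
Qed.

Lemma lamp_volumeE : lamp_volume = #|{ffun V -> bool}|%:R * volume e.
Proof.
by rewrite /lamp_volume sum_lamp/= sumr_const mulr_natl.
Qed.

Lemma sum_delta (T : finType) (z : T) (phi : T -> R) :
  \sum_y (z == y)%:R * phi y = phi z.
Proof.
rewrite (bigD1 z)//= eqxx mul1r big1 ?addr0// => y /negPf yz.
by rewrite eq_sym yz mul0r.
Qed.

Lemma sum_rate phi x : \sum_y rate (lamp_gen e) x y * phi y = lamp_gen e phi x.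
Proof.
case: x => i s; rewrite /rate /lamp_gen.
under eq_bigr do rewrite mulrDl -!mulrA mulrBl mulr_suml.
rewrite big_split/= -!mulr_sumr sumrB !sum_delta exchange_big/=.
congr (_ + _ * _); apply: eq_bigr => j _.
by under eq_bigr do rewrite mulrBl; rewrite sumrB !sum_delta.
Qed.

(** The half in the rates and the half in [dirichlet] give [4^-1]; the 2 cancels the half inside
    [energy]. *)
Lemma dirichlet_lamp f g : (forall i, (0 < deg e i)%N) ->
  dirichlet (lamp_pi R e) (lamp_gen e) f g = lamp_volume^-1 * 4^-1 *
    (\sum_s \sum_i dn i * ((f (i, s) - f (i, flip i s)) *
                           (g (i, s) - g (i, flip i s)))
     + \sum_s 2 * energy e (fun i => f (i, s)) (fun i => g (i, s))).
Proof.
move=> degp; rewrite /dirichlet -big_split/= mulr_sumr sum_lamp mulr_sumr.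
apply: eq_bigr => s _; rewrite /energy mulrA mulfV ?pnatr_eq0// mul1r.
rewrite -big_split/= !mulr_sumr; apply: eq_bigr => i _.
under eq_bigr do rewrite -!mulrA.
(* The product of increments vanishes at the current state, so the generator applied to it is the
   inner sum of the Dirichlet form. *)
have /= h := sum_rate (fun y => (f (i, s) - f y) * (g (i, s) - g y)) (i, s).
rewrite -!mulr_sumr h -/lamp_volume.
rewrite -/(dn i) subrr mul0r subr0.
under [X in _ + _ * X]eq_bigr do rewrite subr0.
field; rewrite !gt_eqF ?ltr0n//.
rewrite lamp_volumeE mulr_gt0//.
  by rewrite ltr0n; apply/card_gt0P; exists s.
by rewrite /volume (bigD1 i)//= ltr_wpDr ?ltr0n//; apply: sumr_ge0.
Qed.

Lemma expect_lamp f :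
  expect (lamp_pi R e) f = (\sum_s \sum_i dn i * f (i, s)) / lamp_volume.
Proof.
rewrite /expect sum_lamp mulr_suml; apply: eq_bigr => s _.
by rewrite mulr_suml; apply: eq_bigr => i _; rewrite /lamp_pi/= mulrAC.
Qed.

End LampForms.

(** * Entropy of the walker given the lamps, and of the lamps *)

Section UpperBound.
Context {R : realType} {V : finType} (e : rel V).
Context (se : symmetric e) (ce : connected_graph e) (V2 : (2 <= #|V|)%N).
Implicit Types x y : V -> R.

Let dn i : R := (deg e i)%:R.
Let vol : R := volume e.
Let gap : R := spectral_gap R e.

Lemma volume_ge1 : 1 <= vol.
Proof.
have /card_gt0P[i _] := ltnW V2.
rewrite /vol /volume (bigD1 i)//= -[leLHS]addr0 lerD ?degr_ge1//.
by apply: sumr_ge0.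
Qed.

Lemma dnorm2_sub_cst x c :
  dnorm2 e (fun i => x i - c) = dnorm2 e x - 2 * c * dsum e x + c ^+ 2 * vol.
Proof.
rewrite /dnorm2 /dsum /vol /volume !mulr_sumr -sumrB -big_split/=.
by apply: eq_bigr => i _; ring.
Qed.

(* The second moment around the quadratic mean is at most twice the variance, to
   which the Poincare inequality applies. *)
Lemma dnorm2_sub_quadratic_mean x : (forall i, 0 <= x i) ->
  dnorm2 e (fun i => x i - Num.sqrt (dnorm2 e x / vol)) <=
  2 / gap * energy e x x.
Proof.
move=> x0; have v1 := volume_ge1; have v0 : 0 < vol by lra.
have ds0 : 0 <= dsum e x by apply: sumr_ge0 => i _; rewrite mulr_ge0.
pose q : R := Num.sqrt (dnorm2 e x / vol); rewrite -/q.
have q2 : q ^+ 2 = dnorm2 e x / vol by rewrite sqr_sqrtr// divr_ge0 ?dnorm2_ge0//; exact: ltW.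
have q0 : 0 <= q by exact: sqrtr_ge0.
have cs : dsum e x / vol <= q.
  have := dnorm2_ge0 e (fun i => x i - dsum e x / vol).
  rewrite dnorm2_sub_cst.
  have -> : dnorm2 e x = q ^+ 2 * vol by rewrite q2 divfK// gt_eqF.
  have -> : q ^+ 2 * vol - 2 * (dsum e x / vol) * dsum e x
      + (dsum e x / vol) ^+ 2 * vol = vol * (q ^+ 2 - (dsum e x / vol) ^+ 2).
    by field; rewrite gt_eqF.
  rewrite pmulr_rge0// subr_ge0 ler_sqr ?nnegrE//.
  by rewrite divr_ge0//; exact: ltW.
have P := spectral_gap_poincare se ce V2 x; rewrite -/gap -/vol in P.
have g0 : 0 < gap by exact: spectral_gap_gt0.
rewrite mulrAC ler_pdivlMr//.
apply: le_trans (_ : 2 * (gap * (dnorm2 e x - dsum e x ^+ 2 / vol)) <= _);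
  last by rewrite ler_wpM2l.
rewrite [leRHS]mulrA [leLHS]mulrC [X in _ <= X * _]mulrC -mulrA.
apply: ler_wpM2l; first exact: ltW.
rewrite dnorm2_sub_cst q2 divfK ?gt_eqF//.
have : dsum e x ^+ 2 / vol <= q * dsum e x.
  by rewrite expr2 -mulrA mulrC ler_wpM2r.
lra.
Qed.

(** Degrees are at least 1, so [f <= vol * m] pointwise. With [p = sqrt f] and [q = sqrt m] this
    gives [(p + q) ^ 2 <= 4 vol q ^ 2], which turns the chi-square bound into one by
    [(p - q) ^ 2]. *)
Lemma graph_entropy_le (f : V -> R) m : (forall i, 0 < f i) ->
  \sum_i dn i * f i = vol * m ->
  \sum_i dn i * (f i * ln (f i)) <= vol * (m * ln m) +
    4 * vol * dnorm2 e (fun i => Num.sqrt (f i) - Num.sqrt m).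
Proof.
move=> f0 fS; have v1 := volume_ge1; have v0 : 0 < vol by lra.
have fm i : f i <= vol * m.
  rewrite -fS (bigD1 i)//= -[leLHS]addr0 lerD//.
    by rewrite ler_peMl ?degr_ge1// ltW.
  by apply: sumr_ge0 => j _; rewrite mulr_ge0// ltW.
have /card_gt0P[i0 _] := ltnW V2.
have m0 : 0 < m.
  by have := fm i0; have := f0 i0; rewrite -(pmulr_rgt0 m v0); exact: lt_le_trans.
have -> : vol * (m * ln m) = \sum_i dn i * (f i * ln m + (f i - m)).
  rewrite (eq_bigr (fun i => dn i * f i * ln m + (dn i * f i - dn i * m))).
    by rewrite big_split/= sumrB -!mulr_suml fS -/(volume e) -/vol subrr addr0 mulrA.
  by move=> i _; ring.
rewrite /dnorm2 mulr_sumr -big_split/=; apply: ler_sum => i _.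
rewrite -/(dn i) [X in _ + X]mulrCA -mulrDr ler_wpM2l ?ler0n//.
apply: le_trans (xlnx_le (f0 i) m0) _; rewrite lerD2l ler_pdivrMr//.
pose p : R := Num.sqrt (f i); pose q : R := Num.sqrt m; rewrite -/p -/q.
have fE : f i = p ^+ 2 by rewrite sqr_sqrtr// ltW.
have mE : m = q ^+ 2 by rewrite sqr_sqrtr// ltW.
have := fm i; rewrite fE; clearbody p q; move: v1; rewrite mE; move: vol => v v1 pq.
have -> : (p ^+ 2 - q ^+ 2) ^+ 2 = (p - q) ^+ 2 * (p + q) ^+ 2 by ring.
rewrite [leRHS](_ : _ = (p - q) ^+ 2 * (4 * v * q ^+ 2)); last by ring.
apply: ler_wpM2l; first exact: sqr_ge0.
by have := sqr_ge0 (p - q); have := sqr_ge0 q; nra.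
Qed.

(** The increment of [sqrt m] is that of [g (j, .)] up to the deviations at [s] and [flip j s],
    whose squares have equal sums. Squaring three terms costs a factor 3, and 6 is 3 + 3. *)
Lemma sqrt_form_le (m : {ffun V -> bool} -> R) (g : lamp_state V -> R) j :
  sqrt_form j m <=
  6 * \sum_s (g (j, s) - Num.sqrt (m s)) ^+ 2
  + 3 * \sum_s (g (j, s) - g (j, flip j s)) ^+ 2.
Proof.
pose r s := g (j, s) - Num.sqrt (m s).
have rS := sum_flip j (fun s => r s ^+ 2).
have -> : 6 * \sum_s (g (j, s) - Num.sqrt (m s)) ^+ 2 =
    3 * \sum_s r s ^+ 2 + 3 * \sum_s r (flip j s) ^+ 2 by rewrite rS -/r; lra.
rewrite -!mulrDr -!big_split/= mulr_sumr; apply: ler_sum => s _.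
have -> : Num.sqrt (m s) - Num.sqrt (m (flip j s)) =
  (g (j, s) - g (j, flip j s)) - r s + r (flip j s) by rewrite /r; ring.
set a := _ - g _; set b := r s; set c := r _; clearbody a b c.
have := sqr_ge0 (a + b); have := sqr_ge0 (a - c); have := sqr_ge0 (b + c).
nra.
Qed.

Lemma entropy_lamp_le (f : lamp_state V -> R) : (forall z, 0 < f z) ->
  entropy (lamp_pi R e) f <=
  20 * vol / gap * dirichlet (lamp_pi R e) (lamp_gen e) f (fun z => ln (f z)).
Proof.
move=> f0; have v1 := volume_ge1; have v0 : 0 < vol by lra.
have g0 : 0 < gap by exact: spectral_gap_gt0.
pose N : R := #|{ffun V -> bool}|%:R.
have N0 : 0 < N by rewrite ltr0n; apply/card_gt0P; exists [ffun=> false].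
pose W : R := lamp_volume e; have WE : W = N * vol by exact: lamp_volumeE.
have W0 : 0 < W by rewrite WE mulr_gt0.
pose g z : R := Num.sqrt (f z).
pose m s : R := (\sum_i dn i * f (i, s)) / vol.
have fS s : \sum_i dn i * f (i, s) = vol * m s.
  by rewrite /m mulrC divfK// gt_eqF.
have /card_gt0P[i0 _] := ltnW V2.
have m0 s : 0 < m s.
  rewrite divr_gt0// (bigD1 i0)//= ltr_wpDr ?mulr_gt0 ?degr_gt0//.
  by apply: sumr_ge0 => j _; rewrite mulr_ge0// ltW.
have dnE s : dnorm2 e (fun i => g (i, s)) = vol * m s.
  by rewrite -fS; apply: eq_bigr => i _; rewrite sqr_sqrtr// ltW.
pose S s := dnorm2 e (fun i => g (i, s) - Num.sqrt (m s)).
pose E s := energy e (fun i => g (i, s)) (fun i => g (i, s)).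
pose FL := \sum_s \sum_i dn i * (g (i, s) - g (i, flip i s)) ^+ 2.
have SE s : S s <= 2 / gap * E s.
  have := dnorm2_sub_quadratic_mean (x := fun i => g (i, s)) _.
  rewrite dnE mulrAC mulfV ?mul1r ?gt_eqF//; apply => i.
  exact: sqrtr_ge0.
(* The 10 is 4 from the walker ([hA]) plus 6 from the lamps ([hT]). *)
have entW : W * entropy (lamp_pi R e) f <=
    vol * (10 * (\sum_s S s) + 3 * FL).
  rewrite /entropy !expect_lamp -/W.
  have -> : \sum_s \sum_i dn i * f (i, s) = vol * \sum_s m s.
    by rewrite mulr_sumr; apply: eq_bigr => s _.
  set A := \sum_s \sum_i _.
  have -> : vol * (\sum_s m s) / W = (\sum_s m s) / N.
    by rewrite WE; field; rewrite !gt_eqF.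
  set M := \sum_s m s.
  have -> : W * (A / W - M / N * ln (M / N)) = A - vol * (M * ln (M / N)).
    by rewrite WE; field; rewrite !gt_eqF.
  have hA : A <= vol * (\sum_s m s * ln (m s)) + 4 * vol * \sum_s S s.
    rewrite [X in _ <= X + _]mulr_sumr [X in _ <= _ + X]mulr_sumr -big_split/=.
    apply: ler_sum => s _.
    exact: (graph_entropy_le (f := fun i => f (i, s)) (fun i => f0 (i, s))).
  have hH := hypercube_entropy_le m0; rewrite -/M -/N in hH.
  (* Lamp [j] only involves the deviation at position [j], so the sum over the lamps is at most
     [\sum_s S s], with no extra factor [#|V|]. *)
  have hT : \sum_j sqrt_form j m <= 6 * (\sum_s S s) + 3 * FL.
    rewrite (_ : \sum_s S s =
      \sum_j \sum_s dn j * (g (j, s) - Num.sqrt (m s)) ^+ 2);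
      last exact: exchange_big.
    rewrite /FL [X in _ + 3 * X]exchange_big/=.
    rewrite [X in _ <= X + _]mulr_sumr [X in _ <= _ + X]mulr_sumr -big_split/=.
    apply: ler_sum => j _; apply: le_trans (sqrt_form_le m g j) _.
    rewrite -!mulr_sumr -/(dn j).
    have d1 := degr_ge1 (R := R) ce V2 j.
    by rewrite lerD// ler_pM2l// ler_peMl//;
      apply: sumr_ge0 => s _; exact: sqr_ge0.
  have hH' := ler_wpM2l (ltW v0) hH; have hT' := ler_wpM2l (ltW v0) hT.
  lra.
have dirW : 2^-1 * FL + \sum_s E s <=
    W * dirichlet (lamp_pi R e) (lamp_gen e) f (fun z => ln (f z)).
  rewrite dirichlet_lamp; last by move=> i; exact: deg_gt0.
  rewrite -/W !mulrA mulfV ?gt_eqF// mul1r mulrDr.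
  have -> : 2^-1 * FL = 4^-1 * (2 * FL) by field.
  have -> : \sum_s E s = 4^-1 * (\sum_s 2 * (2 * E s)).
    by rewrite -!mulr_sumr; field.
  rewrite lerD// ler_pM2l ?invr_gt0// ?mulr_sumr; apply: ler_sum => s _.
    rewrite mulr_sumr; apply: ler_sum => i _.
    by rewrite mulrCA ler_wpM2l ?ler0n// mul_sub_ln_ge.
  rewrite ler_pM2l// /E /energy mulrCA ler_pM2l ?invr_gt0// mulr_sumr.
  apply: ler_sum => i _; rewrite mulr_sumr; apply: ler_sum => j _.
  by rewrite -expr2 mul_sub_ln_ge.
have FL0 : 0 <= FL.
  by apply: sumr_ge0 => s _; apply: sumr_ge0 => i _; rewrite mulr_ge0 ?sqr_ge0.
have SS : \sum_s S s <= 2 / gap * \sum_s E s.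
  by rewrite mulr_sumr; apply: ler_sum => s _.
(* As [gap <= 2], the flip term, which carries no [1 / gap], fits under the same constant. *)
have gap5 : 3 <= 10 / gap.
  by rewrite ler_pdivlMr//; have := spectral_gap_le2 (R := R) se ce V2; rewrite -/gap; lra.
rewrite -(ler_pM2l W0); apply: le_trans entW _.
rewrite mulrCA; apply: le_trans (ler_wpM2l _ dirW); last first.
  by rewrite divr_ge0 ?mulr_ge0// ltW.
have -> : 20 * vol / gap * (2^-1 * FL + \sum_s E s) =
  vol * (10 * (2 / gap * \sum_s E s) + 10 / gap * FL) by field; rewrite gt_eqF.
by rewrite ler_pM2l// lerD ?ler_pM2l// ler_wpM2r.
Qed.

End UpperBound.

(** * Lower bound *)

Section BiasedLamps.
Context {R : realType} {V : finType} (B : {set V}).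
Implicit Types (s : {ffun V -> bool}) (i j : V).

(** A density of mean 1 for the fair coin, so that [biased] is a product density relative to the
    uniform measure. *)
Definition bias j (b : bool) : R :=
  if j \in B then (if b then 3 / 2 else 1 / 2) else 1.

Definition biased s : R := \prod_j bias j (s j).

Lemma bias_gt0 j b : 0 < bias j b.
Proof. by rewrite /bias; case: ifP => _ //; case: b; rewrite divr_gt0. Qed.

Lemma biased_gt0 s : 0 < biased s.
Proof. by apply: prodr_gt0 => j _; exact: bias_gt0. Qed.

Lemma ln_biased s : ln (biased s) = \sum_j ln (bias j (s j)).
Proof.
suff [] : 0 < biased s /\ ln (biased s) = \sum_j ln (bias j (s j)) by [].
apply: (big_ind2 (fun x y => 0 < x /\ ln x = y)) => [|x1 y1 x2 y2|j _].
- by rewrite ln1.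
- by move=> [x10 <-] [x20 <-]; rewrite lnM ?posrE// mulr_gt0.
- by rewrite bias_gt0.
Qed.

Lemma sum_biased : \sum_s biased s = #|{ffun V -> bool}|%:R.
Proof.
rewrite /biased -bigA_distr_bigA/= card_ffun card_bool natrX.
rewrite (eq_bigr (fun=> 2)); first by rewrite prodr_const.
by move=> j _; rewrite big_bool /bias; case: ifP => _ //=; lra.
Qed.

Lemma biased_flip j s : exists G : R,
  biased s = bias j (s j) * G /\ biased (flip j s) = bias j (~~ s j) * G.
Proof.
exists (\prod_(v | v != j) bias v (s v)); split; rewrite /biased (bigD1 j)//=.
rewrite ffunE eqxx; congr (_ * _); apply: eq_bigr => v /negPf vj.
by rewrite ffunE vj.
Qed.

(** Entropy of the density (3/2, 1/2) under the fair coin: the share of one lamp of [B]. *)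
Definition bias_entropy : R := 3 / 4 * ln 3 - ln 2.

Lemma bias_entropy_gt0 : 0 < bias_entropy.
Proof.
rewrite /bias_entropy.
have : ln (2 ^+ 4) < ln (3 ^+ 3) :> R by rewrite ltr_ln ?posrE ?exprn_gt0//; lra.
by rewrite !lnXn//; lra.
Qed.

(** Pairing [s] with [flip j s] isolates the factor of lamp [j]; the product [G] of the others is
    common to both. *)
Lemma sum_biased_ln j : j \in B ->
  \sum_s biased s * ln (bias j (s j)) =
  bias_entropy * #|{ffun V -> bool}|%:R.
Proof.
move=> jB; pose phi s := biased s * ln (bias j (s j)).
rewrite -sum_biased -(sum_avg j) -(sum_avg j (fun s => phi s)) mulr_sumr.
apply: eq_bigr => s _; rewrite /avg /phi ffunE eqxx.
have [G [-> ->]] := biased_flip j s; rewrite /bias jB /bias_entropy.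
have l3 : ln (3 / 2) = ln 3 - ln 2 :> R by rewrite ln_div ?posrE.
have l1 : ln (1 / 2) = - ln 2 :> R by rewrite mul1r lnV ?posrE.
by case: (s j); rewrite /= l3 l1; field.
Qed.

Lemma sum_biased_flip j :
  \sum_s (biased s - biased (flip j s)) *
    (ln (biased s) - ln (biased (flip j s))) =
  (j \in B)%:R * ln 3 * #|{ffun V -> bool}|%:R.
Proof.
have [jB|jB] := boolP (j \in B); last first.
  rewrite !mul0r big1// => s _.
  have [G [-> ->]] := biased_flip j s; rewrite /bias (negPf jB).
  by rewrite subrr mul0r.
rewrite mul1r -sum_biased -(sum_avg j) mulr_sumr.
apply: eq_bigr => s _; rewrite /avg.
have := biased_gt0 s.
have [G [-> ->]] := biased_flip j s; rewrite pmulr_rgt0 ?bias_gt0// => G0.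
rewrite !lnM ?posrE ?bias_gt0// /bias jB.
have l3 : ln (3 / 2) = ln 3 - ln 2 :> R by rewrite ln_div ?posrE.
have l1 : ln (1 / 2) = - ln 2 :> R by rewrite mul1r lnV ?posrE.
by case: (s j); rewrite /= l3 l1; field.
Qed.

End BiasedLamps.

(** * The walker's part of the test function *)

Section TestFunction.
Context {R : realType} {V : finType} (e : rel V).
Context (se : symmetric e) (ce : connected_graph e) (V2 : (2 <= #|V|)%N).

Let dn i : R := (deg e i)%:R.
Let gap : R := spectral_gap R e.

(** One of [x] and [- x] is nonpositive on half of the vertices. Both take positive values, an
    eigenfunction for a nonzero eigenvalue being centred. *)
Lemma half_negative_eigenfunction : exists x : V -> R,
  [/\ forall i, lap e x i = gap * (dn i * x i), exists i, 0 < x i &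
      (#|V| <= 2 * #|[set i | (x i <= 0)%R]%SET|)%N].
Proof.
have [x [[i0 xi0] xE]] := spectral_gap_eigenfunction (R := R) se ce V2.
have g0 : gap != 0 by rewrite gt_eqF// spectral_gap_gt0.
have pos y : (exists i, y i != 0) ->
    (forall i, lap e y i = gap * (dn i * y i)) -> exists i, 0 < y i.
  move=> [i yi0] yE; apply: contrapT => /forallNP np.
  have yle j : 0 <= - y j.
    by rewrite oppr_ge0 leNgt; apply/negP; exact: np.
  have := eigenfunction_dsum se g0 yE; rewrite -[dsum e y]opprK => /eqP.
  rewrite oppr_eq0 /dsum -sumrN.
  rewrite (eq_bigr (fun j => dn j * - y j)); last by move=> j _; rewrite mulrN.
  rewrite psumr_eq0 => [/allP/(_ i (mem_index_enum _))/=|j _]; last first.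
    by rewrite mulr_ge0.
  by rewrite mulf_eq0 oppr_eq0 (negPf yi0) (gt_eqF (degr_gt0 ce V2 i)).
pose x' i := - x i.
have x'E i : lap e x' i = gap * (dn i * x' i).
  rewrite /x' !mulrN -xE -sumrN; apply: eq_bigr => j _.
  by rewrite opprB opprK addrC.
have cov : (#|V| <= #|[set i | (x i <= 0)%R]%SET| + #|[set i | (x' i <= 0)%R]%SET|)%N.
  apply: leq_trans (leq_card_setU _ _); rewrite -cardsT; apply/subset_leq_card.
  by apply/fintype.subsetP => i _; rewrite !inE oppr_le0; exact: le_total.
have [h|h] := leqP #|V| (2 * #|[set i | (x i <= 0)%R]%SET|)%N.
  by exists x; split=> //; apply: pos => //; exists i0.
have aux (n a b : nat) : (n <= a + b -> 2 * a < n -> n <= 2 * b)%N by lia.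
exists x'; split=> //; last exact: aux cov h.
by apply: pos => //; exists i0; rewrite oppr_eq0.
Qed.

Lemma test_function : exists (h : V -> R) (B : {set V}),
  [/\ forall i, 0 < h i, (#|V| <= 2 * #|B|)%N,
      forall i j, e i j -> h j <= 2 * dn i * h i,
      \sum_(i in B) dn i * h i ^+ 2 <= 2 * gap * dnorm2 e h &
      energy e h h <= 4 * gap * dnorm2 e h].
Proof.
have [x [xE [i0 xi0] xB]] := half_negative_eigenfunction.
have g0 : 0 < gap by exact: spectral_gap_gt0.
pose g i : R := Num.max (x i) 0.
have gE0 i : 0 <= g i by rewrite le_max lexx orbT.
have gx i : x i <= g i by rewrite le_max lexx.
(* Where [x > 0], [g] equals [x] and dominates it at the neighbours, so [lap g <= lap x]; elsewhere
   the summand is zero. *)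
have Eg : energy e g g <= gap * dnorm2 e g.
  rewrite -sum_mul_lap// mulr_sumr; apply: ler_sum => i _.
  have [xi|xi] := leP (x i) 0.
    by rewrite /g (max_r xi) mul0r expr0n !mulr0.
  have gi : g i = x i by rewrite /g max_l// ltW.
  rewrite [leRHS](_ : _ = g i * (gap * (dn i * x i))); last by rewrite -gi; ring.
  rewrite ler_wpM2l// -xE; apply: ler_sum => j _.
  by rewrite gi lerD2l lerN2.
have [h hE] := resolvent_exists se ce V2 g.
have hS i : 2 * dn i * h i = dn i * g i + \sum_(j | e i j) h j.
  have := hE i; rewrite /lap sumrB sum_edge_const -/(dn i); lra.
(* Minimum principle: at a minimiser [k] the neighbours sum to at least [dn k * h k], so [hS] gives
   [g k <= h k]. *)
have h0 i : 0 <= h i.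
  have [k _ kmin] := @arg_minP _ _ _ i0 xpredT h isT.
  apply: le_trans (kmin i isT).
  have : dn k * h k <= \sum_(j | e k j) h j.
    by rewrite /dn -sum_edge_const; apply: ler_sum => j _; exact: kmin.
  have dk : 0 < dn k by exact: degr_gt0.
  have : 0 <= dn k * g k by rewrite mulr_ge0.
  by move=> dg hk; rewrite -(pmulr_rge0 (h k) dk); have := hS k; lra.
(* Only the term of [j] is kept in [hS]. The function [g] has no such ratio bound, since it vanishes
   next to positive values. *)
have hnb i j : e i j -> h j <= 2 * dn i * h i.
  move=> eij; rewrite hS (bigD1 j)//= addrCA lerDl.
  by rewrite addr_ge0 ?mulr_ge0//; apply: sumr_ge0.
have hg i : g i <= 2 * h i.
  have dk : 0 < dn i by exact: degr_gt0.
  rewrite -(ler_pM2l dk) mulrCA mulrA hS lerDl; exact: sumr_ge0.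
(* [hnb] carries positivity from [i0] along paths. *)
have hp i : 0 < h i.
  have hi0 : 0 < h i0 by have := hg i0; have := gx i0; lra.
  have /connectP[p] := ce i i0.
  elim: p i => [i _ /= <- //|k p IH i /= /andP[eik pth] lst].
  have hk := IH k pth lst; have := lt_le_trans hk (hnb _ _ eik).
  by rewrite pmulr_rgt0// mulr_gt0 ?degr_gt0.
(* The equation of [h] is tested against [h - g]; the mixed energy is bounded through the
   nonnegative energy of [h - g]. *)
have nrg : dnorm2 e (fun i => h i - g i) + 2^-1 * energy e h h <= 2^-1 * energy e g g.
  have h1 : energy e h (fun i => h i + - 1 * g i) + dnorm2 e (fun i => h i - g i) = 0.
    rewrite -sum_mul_lap// -big_split/= big1// => i _.
    have -> : lap e h i = dn i * g i - dn i * h i by rewrite -hE; ring.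
    by rewrite /dn; ring.
  have h2 := energy_ge0 e (fun i => h i + - 1 * g i).
  rewrite energyDZ in h2.
  rewrite energyC energyDl energyZl (energyC e g h) in h1.
  lra.
have ngh : dnorm2 e g <= 4 * dnorm2 e h.
  rewrite mulr_sumr; apply: ler_sum => i _.
  rewrite [leRHS]mulrCA ler_wpM2l ?ler0n//.
  by have := hg i; have := gE0 i; nra.
have Egh : energy e g g <= 4 * gap * dnorm2 e h.
  by apply: le_trans Eg _; rewrite -mulrA mulrCA ler_pM2l.
exists h, [set i | (x i <= 0)%R]%SET; split=> //.
(* On this set [g] vanishes, so [h] is [h - g], which [nrg] controls. *)
- have : \sum_(i in [set i | (x i <= 0)%R]%SET) dn i * h i ^+ 2
      <= dnorm2 e (fun i => h i - g i).
    rewrite [leRHS](bigID (mem [set i | (x i <= 0)%R]%SET))/= -[leLHS]addr0 lerD//.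
      apply: ler_sum => i; rewrite inE => xi.
      by rewrite /g (max_r xi) subr0.
    by apply: sumr_ge0 => i _; rewrite mulr_ge0 ?sqr_ge0.
  have := energy_ge0 e h; lra.
- have := dnorm2_ge0 e (fun i => h i - g i); lra.
Qed.

End TestFunction.

(** * Entropy against Dirichlet form for the test function *)

Section LowerBound.
Context {R : realType} {V : finType} (e : rel V).
Context (se : symmetric e) (ce : connected_graph e) (V2 : (2 <= #|V|)%N).

Let dn i : R := (deg e i)%:R.
Let vol : R := volume e.
Let gap : R := spectral_gap R e.
Let N : R := #|{ffun V -> bool}|%:R.

Definition biased_test (h : V -> R) (B : {set V}) (z : lamp_state V) : R :=
  h z.1 ^+ 2 * biased B z.2.

(** The entropy of a product splits into that of the lamps and that of [h ^ 2]; the latter is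
    nonnegative by [xlnx_ge] at the mean [q] and is dropped. *)
Lemma biased_test_entropy (h : V -> R) (B : {set V}) : (forall i, 0 < h i) ->
  N * (dnorm2 e h * (#|B|%:R * bias_entropy)) <=
  lamp_volume e * entropy (lamp_pi R e) (biased_test h B).
Proof.
move=> h0; have v1 := volume_ge1 (R := R) ce V2; rewrite -/vol in v1.
have v0 : 0 < vol by lra.
have N0 : 0 < N by rewrite ltr0n; apply/card_gt0P; exists [ffun=> false].
have WE : lamp_volume e = N * vol by exact: lamp_volumeE.
have W0 : 0 < lamp_volume e :> R by rewrite WE mulr_gt0.
have hh i : 0 < h i ^+ 2 by rewrite exprn_gt0.
have /card_gt0P[i0 _] := ltnW V2.
have H0 : 0 < dnorm2 e h by rewrite (dnorm2_gt0 ce V2 (i := i0))// gt_eqF.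
rewrite /entropy !expect_lamp.
have -> : \sum_s \sum_i dn i * biased_test h B (i, s) = N * dnorm2 e h.
  rewrite /N -(sum_biased B) mulr_suml; apply: eq_bigr => s _.
  by rewrite mulr_sumr; apply: eq_bigr => i _; rewrite /biased_test/= -/(dn i); ring.
have -> : N * dnorm2 e h / lamp_volume e = dnorm2 e h / vol.
  by rewrite WE; field; rewrite !gt_eqF.
have -> : \sum_s \sum_i dn i * (biased_test h B (i, s) * ln (biased_test h B (i, s)))
  = N * (\sum_i dn i * (h i ^+ 2 * ln (h i ^+ 2)))
    + N * (dnorm2 e h * (#|B|%:R * bias_entropy)).
  have -> : N * (dnorm2 e h * (#|B|%:R * bias_entropy)) =
      \sum_s \sum_i dn i * h i ^+ 2 * (biased B s * \sum_(j in B) ln (bias B j (s j))).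
    under eq_bigr do rewrite -mulr_suml.
    rewrite -mulr_sumr -/(dnorm2 e h) mulrCA; congr (_ * _).
    under eq_bigr do rewrite mulr_sumr.
    rewrite exchange_big/= (eq_bigr (fun=> bias_entropy * N)); last first.
      by move=> j jB; exact: sum_biased_ln.
    by rewrite sumr_const -mulr_natl; ring.
  rewrite {1}/N -(sum_biased B) mulr_suml -big_split/=; apply: eq_bigr => s _.
  rewrite mulr_sumr -big_split/=; apply: eq_bigr => i _.
  rewrite /biased_test/= lnM ?posrE ?biased_gt0// ln_biased.
  rewrite [in LHS](bigID (mem B))/= [X in _ + (_ + X)]big1 => [|j jB]; first by ring.
  by rewrite /bias (negPf jB) ln1.
have -> : lamp_volume e * ((N * (\sum_i dn i * (h i ^+ 2 * ln (h i ^+ 2)))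
      + N * (dnorm2 e h * (#|B|%:R * bias_entropy))) / lamp_volume e
    - dnorm2 e h / vol * ln (dnorm2 e h / vol)) =
  N * ((\sum_i dn i * (h i ^+ 2 * ln (h i ^+ 2)))
     - dnorm2 e h * ln (dnorm2 e h / vol))
  + N * (dnorm2 e h * (#|B|%:R * bias_entropy)).
  by rewrite WE; field; rewrite !gt_eqF.
rewrite lerDr pmulr_rge0// subr_ge0.
set q := dnorm2 e h / vol; have q0 : 0 < q by rewrite divr_gt0.
have -> : dnorm2 e h * ln q = \sum_i dn i * (h i ^+ 2 * ln q + (h i ^+ 2 - q)).
  rewrite (eq_bigr (fun i => dn i * h i ^+ 2 * ln q
    + (dn i * h i ^+ 2 - dn i * q))); last by move=> i _; ring.
  rewrite big_split/= sumrB -!mulr_suml -/(dnorm2 e h) -/(volume e) -/vol.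
  by rewrite /q [vol * _]mulrC divfK ?gt_eqF// subrr addr0.
by apply: ler_sum => i _; rewrite ler_wpM2l ?ler0n// xlnx_ge.
Qed.

(** On a flip [h i ^ 2] factors out and each lamp of [B] yields [ln 3]. On an edge the lamp density
    factors out and the ratio bound permits [mul_sub_ln_sqr_le]. *)
Lemma biased_test_dirichlet (h : V -> R) (B : {set V}) (c : R) : (forall i, 0 < h i) ->
  (forall i j, e i j -> h j <= c * h i) ->
  lamp_volume e * dirichlet (lamp_pi R e) (lamp_gen e) (biased_test h B)
    (fun z => ln (biased_test h B z)) <=
  4^-1 * (N * (ln 3 * (\sum_(i in B) dn i * h i ^+ 2)
               + 2 * (c + 1) ^+ 2 * energy e h h)).
Proof.
move=> h0 hc.
have hh i : 0 < h i ^+ 2 by rewrite exprn_gt0.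
have v0 : 0 < vol by have := volume_ge1 (R := R) ce V2; rewrite -/vol; lra.
have N0 : 0 < N by rewrite ltr0n; apply/card_gt0P; exists [ffun=> false].
have W0 : 0 < lamp_volume e :> R by rewrite lamp_volumeE mulr_gt0.
have lnE i s : ln (biased_test h B (i, s)) = ln (h i ^+ 2) + ln (biased B s).
  by rewrite /biased_test lnM ?posrE ?biased_gt0.
rewrite dirichlet_lamp; last by move=> i; exact: deg_gt0.
rewrite -[X in _ * X <= _]mulrA mulVKf ?gt_eqF// ler_pM2l ?invr_gt0//.
rewrite mulrDr lerD//.
  rewrite exchange_big/= [leRHS]mulrA [leRHS]mulr_sumr [leRHS]big_mkcond/=.
  apply: ler_sum => i _.
  rewrite (eq_bigr (fun s => dn i * h i ^+ 2 * ((biased B s - biased B (flip i s)) *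
    (ln (biased B s) - ln (biased B (flip i s)))))); last first.
    by move=> s _; rewrite !lnE /biased_test/=; ring.
  rewrite -mulr_sumr sum_biased_flip -/N; case: ifP => _ /=.
    by rewrite le_eqVlt; apply/orP; left; apply/eqP; ring.
  by rewrite !mul0r mulr0.
rewrite {1}/N -(sum_biased B) mulr_suml; apply: ler_sum => s _.
rewrite [leRHS](_ : _ = 2 * (biased B s * (c + 1) ^+ 2 * energy e h h)); last by ring.
rewrite ler_pM2l// /energy.
rewrite [leRHS](_ : _ = 2^-1 * (biased B s * (c + 1) ^+ 2 *
   \sum_i \sum_(j | e i j) (h i - h j) * (h i - h j))); last by ring.
rewrite ler_pM2l ?invr_gt0// mulr_sumr; apply: ler_sum => i _.
rewrite mulr_sumr; apply: ler_sum => j eij; rewrite !lnE /biased_test/=.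
rewrite [leLHS](_ : _ = biased B s *
  ((h i ^+ 2 - h j ^+ 2) * (ln (h i ^+ 2) - ln (h j ^+ 2)))); last by ring.
rewrite -mulrA ler_pM2l ?biased_gt0// -expr2 mul_sub_ln_sqr_le//.
  by apply: hc; rewrite se.
exact: hc.
Qed.

(** The entropy is at least of order [#|B| >= #|V| / 2] times [dnorm2 e h], the Dirichlet form at
    most of order [gap * dnorm2 e h]; [t] is at least their ratio. *)
Lemma mls_constant_ge (d : nat) t : (forall i, (deg e i <= d)%N) ->
  mls_constants (lamp_pi R e) (lamp_gen e) t ->
  bias_entropy / (ln 3 + 4 * (2 * d%:R + 1) ^+ 2) * (#|V|%:R / gap) <= t.
Proof.
move=> degd [t0 tP].
have [h [B [h0 VB hc hB hE]]] := test_function (R := R) se ce V2.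
rewrite -/gap in hB hE.
have g0 : 0 < gap by exact: spectral_gap_gt0.
have N0 : 0 < N by rewrite ltr0n; apply/card_gt0P; exists [ffun=> false].
have /card_gt0P[i0 _] := ltnW V2.
have H0 : 0 < dnorm2 e h by rewrite (dnorm2_gt0 ce V2 (i := i0))// gt_eqF.
have v0 : 0 < vol by have := volume_ge1 (R := R) ce V2; rewrite -/vol; lra.
have W0 : 0 < lamp_volume e :> R by rewrite lamp_volumeE mulr_gt0.
have f0 z : 0 < biased_test h B z by rewrite mulr_gt0 ?exprn_gt0 ?biased_gt0.
have hc' i j : e i j -> h j <= 2 * d%:R * h i.
  move=> eij; apply: le_trans (hc i j eij) _.
  by rewrite ler_wpM2r ?ler_pM2l// ?ler_nat// ltW.
have En := biased_test_entropy B h0.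
have Dn := biased_test_dirichlet B h0 hc'.
have := tP _ f0; rewrite -(ler_pM2l W0) mulrCA => /(le_trans En) ED.
have {}ED := le_trans ED (ler_wpM2l t0 Dn).
have l3 : 0 < ln 3 :> R by rewrite ln_gt0//; lra.
set K := ln 3 + 4 * (2 * d%:R + 1) ^+ 2.
have K0 : 0 < K by rewrite /K ltr_wpDr// mulr_ge0 ?sqr_ge0.
have UB : ln 3 * (\sum_(i in B) dn i * h i ^+ 2)
    + 2 * (2 * d%:R + 1) ^+ 2 * energy e h h <= 2 * K * (gap * dnorm2 e h).
  have a1 := ler_wpM2l (ltW l3) hB.
  have a2 := ler_wpM2l (mulr_ge0 (ler0n R 2) (sqr_ge0 (2 * d%:R + 1 : R))) hE.
  by rewrite /K; lra.
have {}ED : N * (dnorm2 e h * (#|B|%:R * bias_entropy)) <=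
    N * (dnorm2 e h * (t * (2^-1 * (K * gap)))).
  apply: le_trans ED _.
  rewrite [leRHS](_ : _ = t * (4^-1 * (N * (2 * K * (gap * dnorm2 e h))))); last by field.
  by apply: ler_wpM2l => //; rewrite ler_pM2l ?invr_gt0// ler_pM2l.
rewrite ler_pM2l// ler_pM2l// in ED.
have VB' : #|V|%:R <= 2 * #|B|%:R :> R by rewrite -natrM ler_nat.
rewrite (_ : _ * _ = #|V|%:R * bias_entropy / (K * gap)); last first.
  by field; rewrite !gt_eqF.
rewrite ler_pdivrMr ?mulr_gt0//.
have b0 := bias_entropy_gt0 (R := R).
have := ler_wpM2r (ltW b0) VB'; lra.
Qed.

End LowerBound.

(** * Both bounds with constants depending only on [d] *)

Theorem corollary1 (R : realType) (d : nat) (hd : (1 <= d)%N) :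
  exists c C : R,
    0 < c /\ c <= C /\
    forall (V : finType) (e : rel V),
      simple_graph e -> connected_graph e -> (2 <= #|V|)%N -> max_deg e = d ->
      c * (#|V|%:R / spectral_gap R e) <= t_MLS (lamp_pi R e) (lamp_gen e) /\
      t_MLS (lamp_pi R e) (lamp_gen e) <= C * (#|V|%:R / spectral_gap R e).
Proof.
pose c : R := bias_entropy / (ln 3 + 4 * (2 * d%:R + 1) ^+ 2).
have l3 : 0 < ln 3 :> R by rewrite ln_gt0//; lra.
have c0 : 0 < c.
  by rewrite divr_gt0 ?bias_entropy_gt0// ltr_wpDr// mulr_ge0 ?sqr_ge0.
(* The maximum ensures [c <= C]; the value [20 d] comes from [volume e <= d * #|V|]. *)
exists c, (Num.max c (20 * d%:R)); split=> //; split; first by rewrite le_max lexx.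
move=> V e [se _] ce V2 ed.
have degd i : (deg e i <= d)%N by rewrite -ed /max_deg (leq_bigmax i).
have g0 : 0 < spectral_gap R e by exact: spectral_gap_gt0.
pose t0 : R := 20 * volume e / spectral_gap R e.
have t0S : mls_constants (lamp_pi R e) (lamp_gen e) t0.
  split=> [|f f0]; last exact: entropy_lamp_le.
  have v1 := volume_ge1 (R := R) ce V2.
  by rewrite /t0 divr_ge0 ?(ltW g0)// mulr_ge0//; lra.
have [tS tmin] := t_MLS_min (ex_intro _ t0 t0S).
split; first exact: mls_constant_ge.
apply: le_trans (tmin _ t0S) _; rewrite /t0 mulrA ler_pM2r ?invr_gt0//.
apply: (@le_trans _ _ (20 * d%:R * #|V|%:R)).
  rewrite -mulrA ler_pM2l// mulr_natr -sumr_const.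
  by apply: ler_sum => i _; rewrite ler_nat.
by rewrite ler_wpM2r// le_max lexx orbT.
Qed.
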